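(* Let $\rho,\eta,\beta>0$. Suppose that $f\colon\mathbb{R}^d\to\mathbb{R}\cup\{\infty\}$ is closed, $\rho$-weakly convex and not identically $+\infty$, and that for every $x\in\mathbb{R}^d$ there is a closed $\eta$-weakly convex function $f_x\colon\mathbb{R}^d\to\mathbb{R}\cup\{\infty\}$ satisfying $|f(y)-f_x(y)|\le\frac{\beta}{2}\|y-x\|^2$ for all $y\in\mathbb{R}^d$. Let $\alpha\in(0,1]$ and $\tau>\max\{\eta,2\rho,\frac{4\beta+\rho+\eta}{2}\}$, set $\hat\rho=\frac12\tau+\frac14(\rho+\eta)$, and given $x_0\in\mathbb{R}^d$ define for $t\ge0$ $$y_t=\mathrm{argmin}_{y\in\mathbb{R}^d}\left\{f_{x_t}(y)+\frac{\tau}{2}\|y-x_t\|^2\right\},\qquad x_{t+1}=(1-\alpha)x_t+\alpha y_t.$$ Then for all $T\ge0$, $$\min_{t=0,\ldots,T}\|\nabla f_{1/\hat\rho}(x_t)\|\le\sqrt{\frac{f_{1/\hat\rho}(x_0)-\inf f}{\frac{\alpha(2\hat\rho-\rho-\eta-\beta)}{2\hat\rho(\hat\rho+\tau-\rho-\eta)}(T+1)}}.$$ Moreover, suppose in addition that for every $\sigma>\rho$ the Moreau envelope $f_{1/\sigma}$ is a Kurdyka-Łojasiewicz (KL) function, and that the sequence $\{x_t\}$ has a cluster point $\bar x$. Then $\bar x$ is critical for $f$, the entire sequence $\{x_t\}$ converges to $\bar x$, and the sequence has finite length: $$\sum_{t=0}^\infty\|x_{t+1}-x_t\|<+\infty.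$$
   Context: A function $f$ is closed if its epigraph is closed, and $\rho$-weakly convex if $x\mapsto f(x)+\frac{\rho}{2}\|x\|^2$ is convex. The bound $|f(y)-f_x(y)|\le\frac\beta2\|y-x\|^2$ is understood to mean that $f(y)$ and $f_x(y)$ are either both $+\infty$ or both finite and satisfying the inequality. For $\mu\in(0,\rho^{-1})$ the Moreau envelope is $f_\mu(x)=\inf_y\{f(y)+\frac{1}{2\mu}\|y-x\|^2\}$ (it is $C^1$-smooth). If $\inf f=-\infty$, the right-hand side of the displayed bound is $+\infty$. Subdifferential: if $g(\bar x)$ is finite, $\partial g(\bar x)$ is the set of $v$ with $g(x)\ge g(\bar x)+\langle v,x-\bar x\rangle+o(\|x-\bar x\|)$ as $x\to\bar x$; $\partial g(\bar x)=\emptyset$ if $g(\bar x)=\infty$. A point $\bar x$ is critical for $g$ if $0\in\partial g(\bar x)$. KL function: a closed function $g\colon\mathbb{R}^d\to\mathbb{R}\cup\{\infty\}$ has the KL property at a point $\bar x$ with $\partial g(\bar x)\neq\emptyset$ if there exist $\varepsilon\in(0,+\infty]$, a neighborhood $U$ of $\bar x$, and a continuous concave function $\varphi\colon[0,\varepsilon)\to[0,\infty)$ such that $\varphi(0)=0$; $\varphi$ is $C^1$ on $(0,\varepsilon)$ with $\varphi'>0$; and $\mathrm{dist}(0,\partial g(x))\ge\frac{1}{\varphi'(g(x)-g(\bar x))}$ for all $x\in U$ with $g(\bar x)<g(x)<g(\bar x)+\varepsilon$. If $g$ has the KL property at each point $x$ with $\partial g(x)\ne\emptyset$, it is called a KL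 function. *)

(* Defs.v *)
From HB Require Import structures.
From mathcomp Require Import all_boot all_order all_algebra.
From mathcomp Require Import all_classical all_reals all_analysis.

Set Implicit Arguments.
Unset Strict Implicit.
Unset Printing Implicit Defensive.

Import Order.TTheory GRing.Theory Num.Theory.
Import numFieldNormedType.Exports.

Local Open Scope classical_set_scope.
Local Open Scope ring_scope.

Section Euclidean.
Context {R : realType} {d : nat}.
Implicit Types (u v x : 'rV[R]_d) (h : 'rV[R]_d -> R).

Definition dotp u v : R := \sum_(i < d) u ord0 i * v ord0 i.

(* The library norm on 'rV[R]_d is the sup norm; only its topology, which is
   the usual one of R^d, is used below. *)
Definition enorm u : R := Num.sqrt (dotp u u).

(* The vector of partial derivatives; it is the gradient wherever h is
   differentiable. *)
Definition grad h x : 'rV[R]_d :=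
  \row_(i < d) 'D_(delta_mx ord0 i : 'rV[R]_d) h x.

End Euclidean.

Local Open Scope ereal_scope.

Section ExtendedFunctions.
Context {R : realType} {d : nat}.
Implicit Types (f g : 'rV[R]_d -> \bar R) (x y v : 'rV[R]_d).

(* Functions R^d -> R U {oo} are represented as functions into \bar R that
   avoid -oo. *)
Definition avoids_ninfty f := forall x, f x != -oo.

Definition closed_function f :=
  closed [set p : 'rV[R]_d * R | f p.1 <= (p.2)%:E].

(* The conventions 0 * oo = 0 and oo + r = oo make the inequality the usual
   one for functions avoiding -oo. *)
Definition ext_convex f := forall x y (t : R), (0 <= t <= 1)%R ->
  f (t *: x + (1 - t) *: y)%R <= t%:E * f x + (1 - t)%:E * f y.

Definition weakly_convex (rho : R) f :=
  ext_convex (fun x => f x + (rho / 2 * enorm x ^+ 2)%:E).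

(* |f(y) - g(y)| <= r, in the sense that f(y) and g(y) are both +oo or both
   finite and satisfying the inequality. *)
Definition ext_close f g y (r : R) :=
  (f y = +oo /\ g y = +oo) \/
  [/\ f y \is a fin_num, g y \is a fin_num &
      (`|fine (f y) - fine (g y)| <= r)%R].

Definition moreau (mu : R) f x : \bar R :=
  ereal_inf (range (fun y => f y + (1 / (2 * mu) * enorm (y - x) ^+ 2)%:E)).

(* The point y such that {y} is the set of minimizers of g (an arbitrary point
   if there is no such y). *)
Definition argmin g : 'rV[R]_d :=
  get [set y | [set z | forall w, g z <= g w] = [set y]].

(* The o(||y - x||) minorant is written in epsilon form. *)
Definition subdiff g x : set 'rV[R]_d :=
  [set v | g x \is a fin_num /\
    forall e : R, (0 < e)%R -> \forall y \near x,
      g x + (dotp v (y - x) - e * enorm (y - x))%:E <= g y].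

Definition critical g x := subdiff g x 0%R.

(* +oo when the subdifferential is empty *)
Definition dist0_subdiff g x : \bar R :=
  ereal_inf [set (enorm v)%:E | v in subdiff g x].

Definition desingularizing (eps : \bar R) (phi : R -> R) :=
  let D := [set s : R | (0 <= s)%R /\ s%:E < eps] in
  [/\ {within D, continuous phi},
      convex_function (D : set (convex_lmodType R^o)) (fun s => - phi s)%R,
      (forall s, D s -> (0 <= phi s)%R),
      phi 0%R = 0%R &
      forall s : R, (0 < s)%R -> s%:E < eps ->
        [/\ derivable phi s 1, {for s, continuous (derive1 phi : R -> R)} &
            (0 < derive1 phi s)%R]].

Definition KL_at g xbar :=
  exists (eps : \bar R) (U : set 'rV[R]_d) (phi : R -> R),
    [/\ 0 < eps, nbhs xbar U, desingularizing eps phi &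
        forall x, U x -> g xbar < g x -> g x < g xbar + eps ->
          (1 / derive1 phi (fine (g x) - fine (g xbar)))%:E <= dist0_subdiff g x].

Definition KL_function g :=
  [/\ avoids_ninfty g, closed_function g &
      forall x, subdiff g x !=set0 -> KL_at g x].

End ExtendedFunctions.

(* Main.v *)
Require Import Defs.
From HB Require Import structures.
From mathcomp Require Import all_boot all_order all_algebra.
From mathcomp Require Import all_classical all_reals all_analysis.
From mathcomp Require Import ring lra.

Set Implicit Arguments.
Unset Strict Implicit.
Unset Printing Implicit Defensive.

Import Order.TTheory GRing.Theory Num.Theory.
Import numFieldNormedType.Exports.

Local Open Scope classical_set_scope.
Local Open Scope ring_scope.

(* Let c = rhohat, s = tau - c > beta, and let p be the proximal point of f at
   x_t. Strong convexity of f + c/2 |. - x_t|^2 and of the model subproblem,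
   compared at p and y_t through the model error bound, give
     (s - beta) |y_t - x_t|^2 + 3 s |y_t - p|^2 <= (s + beta) |p - x_t|^2.
   Evaluating the Moreau envelope at x_{t+1} with competitor p then yields a
   decrease by positive multiples of |p - x_t|^2 + |y_t - x_t|^2, where
   c (x_t - p) is the gradient of the envelope. Summing bounds the smallest
   gradient. By AM-GM the decrease also dominates the product of the gradient
   norm and the step length, so the desingularizing function of the envelope at
   a cluster point telescopes against the step lengths. *)

(** * Euclidean geometry of row vectors *)

Section EuclideanGeometry.
Context {R : realType} {d : nat}.
Implicit Types (u v w x y z : 'rV[R]_d).

Lemma enorm_sqr u : enorm u ^+ 2 = dotp u u.
Proof. by rewrite sqr_sqrtr// sumr_ge0// => i _; exact: sqr_ge0. Qed.

Lemma enorm_ge0 u : 0 <= enorm u.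
Proof. exact: sqrtr_ge0. Qed.

Lemma enorm0 : enorm (0 : 'rV[R]_d) = 0.
Proof. by rewrite /enorm /dotp big1 ?sqrtr0// => i _; rewrite mxE mul0r. Qed.

Lemma dotpC u v : dotp u v = dotp v u.
Proof. by apply: eq_bigr => i _; rewrite mulrC. Qed.

Lemma dotpZr (a : R) u v : dotp u (a *: v) = a * dotp u v.
Proof. by rewrite mulr_sumr; apply: eq_bigr => i _; rewrite !mxE mulrCA. Qed.

Lemma dotpZl (a : R) u v : dotp (a *: u) v = a * dotp u v.
Proof. by rewrite dotpC dotpZr dotpC. Qed.

Lemma enormZ (a : R) u : enorm (a *: u) = `|a| * enorm u.
Proof.
by rewrite /enorm dotpZr dotpC dotpZr mulrA -expr2 sqrtrM ?sqr_ge0// sqrtr_sqr.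
Qed.

Lemma enormN u : enorm (- u) = enorm u.
Proof. by rewrite -scaleN1r enormZ normrN1 mul1r. Qed.

Lemma enorm_subC u v : enorm (u - v) = enorm (v - u).
Proof. by rewrite -opprB enormN. Qed.

Lemma sq_enormD u v :
  enorm (u + v) ^+ 2 = enorm u ^+ 2 + 2 * dotp u v + enorm v ^+ 2.
Proof.
rewrite !enorm_sqr mulr_sumr -!big_split/=.
by apply: eq_bigr => i _; rewrite !mxE; ring.
Qed.

(** The defect [t * (1 - t) * enorm (u - v) ^+ 2] is exact. It supplies the strong convexity of
    proximal objectives and the expansion of a relaxed step. *)
Lemma sq_enorm_conv (t : R) u v w :
  enorm (t *: u + (1 - t) *: v - w) ^+ 2 =
  t * enorm (u - w) ^+ 2 + (1 - t) * enorm (v - w) ^+ 2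
  - t * (1 - t) * enorm (u - v) ^+ 2.
Proof.
rewrite !enorm_sqr !mulr_sumr -big_split -sumrB/=.
by apply: eq_bigr => i _; rewrite !mxE; ring.
Qed.

Lemma sq_enorm_polar u x z :
  enorm (u - z) ^+ 2 =
  enorm (u - x) ^+ 2 + 2 * dotp (x - u) (z - x) + enorm (z - x) ^+ 2.
Proof.
rewrite !enorm_sqr mulr_sumr -!big_split/=.
by apply: eq_bigr => i _; rewrite !mxE; ring.
Qed.

(** These are the cross terms that remain when two envelope inequalities with [x] and [z] exchanged
    are added. *)
Lemma dotp_cross x z u v : dotp (x - u) (z - x) + dotp (z - v) (x - z) =
  dotp (u - v) (x - z) - enorm (x - z) ^+ 2.
Proof.
rewrite enorm_sqr -big_split -sumrB/=.
by apply: eq_bigr => i _; rewrite !mxE; ring.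
Qed.

Lemma enorm_eq0 u : enorm u = 0 -> u = 0.
Proof.
move=> u0; have: dotp u u = 0 by rewrite -enorm_sqr u0 expr0n.
rewrite /dotp => /eqP; rewrite psumr_eq0 => [/allP u00|i _]; last exact: sqr_ge0.
apply/rowP => i; rewrite mxE; have := u00 i (mem_index_enum i).
by rewrite mulf_eq0 orbb => /eqP.
Qed.

(** Cauchy-Schwarz: expand the square of [enorm v *: u - enorm u *: v] and cancel the factor
    [enorm u * enorm v], after treating null vectors apart. *)
Lemma dotp_le u v : dotp u v <= enorm u * enorm v.
Proof.
have [/enorm_eq0 ->|u0] := eqVneq (enorm u) 0.
  by rewrite /dotp enorm0 mul0r big1// => i _; rewrite mxE mul0r.
have [/enorm_eq0 ->|v0] := eqVneq (enorm v) 0.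
  by rewrite /dotp enorm0 mulr0 big1// => i _; rewrite mxE mulr0.
have uv : 0 < enorm u * enorm v by rewrite mulr_gt0// lt0r ?u0 ?v0 enorm_ge0.
have := sqr_ge0 (enorm (enorm v *: u + (- enorm u) *: v)).
rewrite sq_enormD !enormZ normrN !ger0_norm ?enorm_ge0//.
rewrite dotpZr dotpZl => H.
rewrite -(ler_pM2l uv); move: H.
set a := enorm u; set b := enorm v; set c := dotp u v => H; nra.
Qed.

Lemma dotp_abs_le u v : `|dotp u v| <= enorm u * enorm v.
Proof.
rewrite ler_norml dotp_le andbT lerNl -(enormN u).
by apply: le_trans (dotp_le _ _); rewrite -[- u]scaleN1r dotpZl mulN1r.
Qed.

Lemma enormD u v : enorm (u + v) <= enorm u + enorm v.
Proof.
rewrite -(@ler_pXn2r _ 2) ?nnegrE ?addr_ge0 ?enorm_ge0//.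
rewrite sq_enormD sqrrD lerD2r lerD2l -[leRHS]mulr_natl ler_pM2l//.
exact: dotp_le.
Qed.

Lemma enorm_tri y x z : enorm (x - z) <= enorm (x - y) + enorm (y - z).
Proof. by apply: le_trans (enormD _ _); rewrite addrA subrK. Qed.

(** Together with the continuity of [enorm], this one inequality matches Euclidean balls with the
    neighborhoods of the sup norm. *)
Lemma norm_le_enorm u : `|u| <= enorm u.
Proof.
rewrite [leLHS]/Num.Def.normr/= mx_normrE; apply/bigmax_leP; split; first exact: enorm_ge0.
move=> [i j] _ /=; rewrite (ord1 i) -sqrtr_sqr ler_sqrt/dotp.
  by rewrite (bigD1 j)//= expr2 lerDl sumr_ge0// => k _; exact: sqr_ge0.
by rewrite sumr_ge0// => k _; exact: sqr_ge0.
Qed.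

Lemma continuous_enorm_sub x : continuous (fun y => enorm (y - x)).
Proof.
have dotp_cont : continuous (fun y => dotp (y - x) (y - x)).
  apply: continuous_big => [|i _]; first exact: add_continuous.
  have c : continuous (fun z : 'rV[R]_d => (z - x) ord0 i).
    rewrite (_ : (fun _ => _) = (fun z : 'rV[R]_d => z ord0 i - x ord0 i)).
      by move=> y; apply: continuousB; [exact: coord_continuous|exact: cst_continuous].
    by apply/funext => z; rewrite !mxE.
  by move=> y; apply: continuousM; exact: c.
move=> y; apply: (@continuous_comp _ _ _ (fun y => dotp (y - x) (y - x))).
  exact: dotp_cont.
exact: sqrt_continuous.
Qed.

Lemma near_enorm_lt x (e : R) : 0 < e -> \forall y \near x, enorm (y - x) < e.
Proof.
move=> e0; have := @continuous_enorm_sub x x.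
rewrite /continuous_at subrr enorm0 => /cvgrPdist_lt/(_ _ e0).
by apply: filterS => y; rewrite sub0r normrN ger0_norm// enorm_ge0.
Qed.

Lemma nbhs_enormP x (U : set 'rV[R]_d) : nbhs x U ->
  exists2 r : R, 0 < r & forall y, enorm (y - x) < r -> U y.
Proof.
move=> /nbhs_ballP[r /= r0 rU]; exists r => // y yr; apply: rU.
rewrite -ball_normE/= distrC; exact: le_lt_trans (norm_le_enorm _) yr.
Qed.

Lemma closed_enorm_ball x (r : R) : closed [set y | enorm (y - x) <= r].
Proof.
apply: (@preimage_closed _ _ (fun y => enorm (y - x)) [set s : R | s <= r]).
  by move=> y _; exact: continuous_enorm_sub.
exact: closed_le.
Qed.

Lemma compact_enorm_ball x (r : R) : compact [set y | enorm (y - x) <= r].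
Proof.
apply: bounded_closed_compact; last exact: closed_enorm_ball.
exists (`|x| + r); split; first exact: num_real.
move=> M rM y /= yr; rewrite -(subrK x y); apply: le_trans (ltW rM).
rewrite addrC (le_trans (ler_normD _ _))// lerD2l.
exact: le_trans (norm_le_enorm _) yr.
Qed.

End EuclideanGeometry.

(** * Minimizers of strongly convex functions *)

(** A minimizing sequence clusters in [K], and closed sublevel sets, that is lower semicontinuity,
    carry the bound on its values over to the cluster point. *)
Lemma lsc_min_compact (R : realType) (T : topologicalType) (K : set T) (H : T -> \bar R) :
  compact K -> K !=set0 -> (forall y, H y != -oo%E) ->
  (forall c : R, closed [set y | (H y <= c%:E)%E]) ->
  exists2 p, K p & forall z, K z -> (H p <= H z)%E.
Proof.
move=> cK [z0 Kz0] HN clH.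
have /ereal_inf_seq[u uS ul] : H @` K != set0.
  by apply/set0P; exists (H z0), z0.
have /choice[s sP] : forall i, exists z, K z /\ H z = u i.
  by move=> i; have [z Kz zu] := uS i; exists z.
have [|p [Kp cp]] := cK (s @ \oo) _.
  by exists 0%N => // i _; exact: (sP i).1.
exists p => // z Kz.
suff : (H p <= ereal_inf (H @` K))%E.
  by move/le_trans; apply; apply: ereal_inf_lbound; exists z.
rewrite leNgt; apply/negP => iltp.
(* A real [c] would separate the infimum from [H p]. The sequence eventually lies in the closed set
   where [H] is at most [c], so its cluster point [p] lies there too. *)
have [c [ci cp']] : exists c : R, (ereal_inf (H @` K) < c%:E)%E /\ (c%:E < H p)%E.
  move: iltp (HN p); case: (ereal_inf _) => [i||]; case: (H p) => [r||]//=.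
  - rewrite lte_fin => ir _; exists ((i + r) / 2); rewrite !lte_fin; split; lra.
  - by move=> _ _; exists (i + 1); rewrite lte_fin ltrDl ltr01 ltry.
  - by move=> _ _; exists (r - 1); rewrite ltNyr lte_fin ltrBlDr ltrDl ltr01.
  - by move=> _ _; exists 0; rewrite ltNyr ltry.
move: cp'; apply/negP; rewrite -leNgt.
move: cp; rewrite clusterE => /(_ [set y | (H y <= c%:E)%E]).
rewrite -(closure_id _).1; last exact: clH.
apply; have : nbhs (ereal_inf (H @` K)) [set y | (y < c%:E)%E].
  by apply: open_nbhs_nbhs; split => //; exact: open_ereal_lt_ereal.
by move=> /ul[N _ NP]; exists N => // i /NP /=; rewrite (sP i).2 => /ltW.
Qed.

Section StrongConvexity.
Context {R : realType} {d : nat}.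
Implicit Types (h H : 'rV[R]_d -> \bar R) (p x y z w : 'rV[R]_d).

(** The inequality is required only between points of finite value, so its right-hand side is a real
    number and no arithmetic with [+oo] arises. *)
Definition strongly_convex (m : R) H := forall z w (a b t : R),
  0 <= t <= 1 -> H z = a%:E -> H w = b%:E ->
  (H (t *: z + (1 - t) *: w)%R <=
     (t * a + (1 - t) * b - m / 2 * (t * (1 - t)) * enorm (z - w) ^+ 2)%:E)%E.

Definition prox_objective (c : R) x h y : \bar R :=
  (h y + (c / 2 * enorm (y - x) ^+ 2)%R%:E)%E.

(** The defect identity is applied around the origin to the weak convexity term and around [x] to
    the proximal term. Both produce the same defect, with weights [k / 2] and [c / 2], and the
    difference is the modulus. *)
Lemma prox_objective_strongly_convex (k c : R) x h :
  weakly_convex k h -> strongly_convex (c - k) (prox_objective c x h).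
Proof.
move=> hk z w a b t t01; rewrite /prox_objective.
case Ez : (h z) => [a'||]//= -[<-]; case Ew : (h w) => [b'||]//= -[<-].
have := hk z w t t01; rewrite Ez Ew -!EFinD.
case: (h _) => [r|/=|_]; [|by []|by rewrite leNye].
rewrite -!EFinD !lee_fin.
have := sq_enorm_conv t z w 0; rewrite !subr0 => ->.
rewrite (sq_enorm_conv t z w x).
set A := enorm (z - x) ^+ 2; set B := enorm (w - x) ^+ 2.
set C := enorm (z - w) ^+ 2; set D := enorm z ^+ 2; set E := enorm w ^+ 2.
move=> ?; lra.
Qed.

(** The sublevel set is the preimage of the epigraph of [h] under a continuous map. *)
Lemma prox_objective_closed_sublevel (c : R) x h (s : R) :
  closed_function h -> closed [set y | (prox_objective c x h y <= s%:E)%E].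
Proof.
move=> clh; rewrite (_ : [set y | _] =
    (fun y => (y, s - c / 2 * enorm (y - x) ^+ 2)) @^-1`
    [set p | (h p.1 <= p.2%:E)%E]).
  have qc : continuous (fun y => s - c / 2 * enorm (y - x) ^+ 2).
    have rc : continuous (fun v : R => s - c / 2 * v ^+ 2).
      move=> v; apply: cvgB; first exact: cvg_cst.
      apply: cvgM; first exact: cvg_cst.
      exact: exprn_continuous.
    move=> y; apply: (@continuous_comp _ _ _ (fun y => enorm (y - x))
      (fun v : R => s - c / 2 * v ^+ 2)); last exact: rc.
    exact: continuous_enorm_sub.
  have pc : continuous (fun y => (y, s - c / 2 * enorm (y - x) ^+ 2)).
    by move=> y; exact: (cvg_pair cvg_id (qc y)).
  by apply: preimage_closed clh => y _; exact: pc.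
apply/seteqP; split => y; rewrite /= /prox_objective;
  by rewrite EFinB leeBrDr.
Qed.

(** Compactness gives a minimizer on a ball around [z0], strong convexity rules out lower values
    outside that ball, and comparison along segments ending at the minimizer gives quadratic
    growth. *)
Lemma strongly_convex_minimizer (m : R) H : 0 < m ->
  (forall y, H y != -oo%E) -> (forall c : R, closed [set y | (H y <= c%:E)%E]) ->
  strongly_convex m H -> (exists z, H z != +oo%E) ->
  exists2 p, H p \is a fin_num &
    forall z, (H p + (m / 2 * enorm (z - p) ^+ 2)%:E <= H z)%E.
Proof.
move=> m0 HN clH scH [z0 z0y].
have [a0 Ha0] : exists a0, H z0 = a0%:E.
  by move: z0y (HN z0); case: (H z0) => // r; exists r.
have ball_min (r : R) : 0 <= r ->
    exists p q, [/\ enorm (p - z0) <= r, H p = q%:E, q <= a0 &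
      forall z, enorm (z - z0) <= r -> (q%:E <= H z)%E].
  move=> r0; have Kz0 : enorm (z0 - z0) <= r by rewrite subrr enorm0.
  have [|p Kp pmin] := lsc_min_compact (compact_enorm_ball (x := z0) (r := r)) _ HN clH.
    by exists z0.
  move: (pmin _ Kz0) (HN p); rewrite Ha0; case Ep : (H p) => [q||]// qa _.
  by exists p, q; split => // z Kz; rewrite -Ep; exact: pmin.
have [_ [m1 [_ _ m1a m1P]]] := ball_min 1 ler01.
(* At distance more than [r] from [z0], a value below [a0] would force, by strong convexity, a value
   below [m1] on the unit sphere around [z0]. *)
set r := 1 + 2 * (a0 - m1) / m.
have r1 : 1 <= r by rewrite lerDl divr_ge0 ?(ltW m0)// mulr_ge0// subr_ge0.
have [|p [q [_ Hp qa qP]]] := ball_min r; first by lra.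
have pmin z : (q%:E <= H z)%E.
  have [/qP//|rz] := leP (enorm (z - z0)) r.
  case Hz : (H z) (HN z) => [b||]// _; last by rewrite leey.
  rewrite lee_fin.
  have [ab|ba] := leP a0 b; first lra.
  exfalso.
  set s := enorm (z - z0) in rz.
  have s1 : 1 < s by lra.
  (* The weight [s^-1] puts the combination of [z] and [z0] at distance exactly 1 from [z0], where
     [m1] is a lower bound. *)
  have t01 : 0 <= s^-1 <= 1 by rewrite invr_ge0 invf_le1; lra.
  have := scH _ _ _ _ _ t01 Hz Ha0.
  have := m1P (s^-1 *: z + (1 - s^-1) *: z0).
  rewrite (_ : _ - z0 = s^-1 *: (z - z0)); last first.
    by apply/rowP => i; rewrite !mxE; ring.
  rewrite enormZ ger0_norm ?(andP t01).1// mulVf ?(gt_eqF (lt_trans ltr01 s1))//.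
  move=> /(_ (lexx _)) /le_trans /[apply]; rewrite lee_fin -/s => H1.
  have H2 : s * m1 <= b + (s - 1) * a0 - m / 2 * ((s - 1) * s).
    have -> : b + (s - 1) * a0 - m / 2 * ((s - 1) * s) =
      s * (s^-1 * b + (1 - s^-1) * a0 - m / 2 * (s^-1 * (1 - s^-1)) * s ^+ 2).
      by field; lra.
    by rewrite ler_pM2l//; lra.
  have H3 : m * (r - 1) = 2 * (a0 - m1) by rewrite /r; field; lra.
  have : m * (r - 1) < m * (s - 1) by rewrite ltr_pM2l//; lra.
  nra.
exists p; rewrite Hp// => z.
case Hz : (H z) (HN z) => [b||]// _; last by rewrite leey.
rewrite -EFinD lee_fin; set D := enorm (z - p) ^+ 2.
have D0 : 0 <= D by exact: sqr_ge0.
(* Strong convexity between [z] and [p] is divided by the weight [t] of [z]; quadratic growth is the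
   limit as [t] tends to 0. *)
have tineq t : 0 < t -> t < 1 -> q + m / 2 * D <= b + m / 2 * D * t.
  move=> t0 t1; have t01 : 0 <= t <= 1 by lra.
  have := le_trans (pmin _) (scH _ _ _ _ _ t01 Hz Hp); rewrite lee_fin -/D => H1.
  rewrite -(ler_pM2l t0); nra.
apply/ler_addgt0Pr => e e0.
have [mD|mD] := leP (m / 2 * D) e.
  have := tineq (1 / 2); nra.
have mD0 : 0 < m / 2 * D by lra.
(* This weight makes the error term of [tineq] equal to [e]. *)
have := tineq (e / (m / 2 * D)); rewrite divr_gt0// ltr_pdivrMr// mul1r.
by move=> /(_ isT mD); rewrite [m / 2 * D * _]mulrC divfK ?gt_eqF.
Qed.

(* Quadratic growth around the minimizer gives uniqueness, hence [argmin] is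
   not a junk value. *)
Lemma argmin_strong_min (m : R) H p : 0 < m -> H p \is a fin_num ->
  (forall z, (H p + (m / 2 * enorm (z - p) ^+ 2)%:E <= H z)%E) -> argmin H = p.
Proof.
move=> m0 Hp pmin.
have Hle w : (H p <= H w)%E.
  by apply: le_trans (pmin w); rewrite leeDl// lee_fin mulr_ge0 ?sqr_ge0//; lra.
have minE : [set z | forall w, (H z <= H w)%E] = [set p].
  apply/seteqP; split => [z /= zmin|_ -> //].
  have := le_trans (pmin z) (zmin p).
  move: Hp; case: (H p) => // a _; rewrite -EFinD lee_fin gerDl => D0.
  have : enorm (z - p) ^+ 2 <= 0 by rewrite -(pmulr_rle0 _ (_ : 0 < m / 2))//; lra.
  rewrite le_eqVlt ltNge sqr_ge0 orbF sqrf_eq0 => /eqP/enorm_eq0/eqP.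
  by rewrite subr_eq0 => /eqP.
have /getPex : exists y, [set z | forall w, (H z <= H w)%E] = [set y] by exists p.
rewrite -/(argmin H) /= minE => E; suff : [set argmin H] p by [].
by rewrite -E.
Qed.

Lemma prox_exists (k c : R) x h : k < c -> avoids_ninfty h -> closed_function h ->
  weakly_convex k h -> (exists z, h z != +oo%E) ->
  exists2 p, h p \is a fin_num &
    argmin (prox_objective c x h) = p /\
    forall z, (prox_objective c x h p + ((c - k) / 2 * enorm (z - p) ^+ 2)%:E
      <= prox_objective c x h z)%E.
Proof.
move=> kc hN hcl hk [z0 z0y]; have ck : 0 < c - k by lra.
have finE y : (prox_objective c x h y \is a fin_num) = (h y \is a fin_num).
  by rewrite /prox_objective fin_numD andbT.
have [| | |p Hp pmin] := strongly_convex_minimizer ck _ _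
    (prox_objective_strongly_convex (c := c) (x := x) hk).
- by move=> y; rewrite /prox_objective; case: (h y) (hN y).
- by move=> s; exact: prox_objective_closed_sublevel.
- by exists z0; rewrite /prox_objective; case: (h z0) z0y.
by exists p; [rewrite -finE|split => //; exact: argmin_strong_min pmin].
Qed.

End StrongConvexity.

(** * Moreau envelopes *)

Section FirstOrderExpansion.
Context {R : realType} {d : nat}.
Variables (g : 'rV[R]_d -> R) (x v : 'rV[R]_d) (K : R).
Hypotheses (K0 : 0 <= K)
  (gK : forall z, `|g z - g x - dotp v (z - x)| <= K * enorm (z - x) ^+ 2).

(** The difference quotient with increment [t] is off by at most [K * enorm w ^+ 2] times the
    absolute value of [t]. *)
Lemma expansion_derive (w : 'rV[R]_d) : 'D_w g x = dotp v w.
Proof.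
apply: cvg_lim => //; apply/cvgrPdist_lt => e e0.
set M := K * enorm w ^+ 2; have M0 : 0 <= M by rewrite mulr_ge0// sqr_ge0.
have M1 : 0 < M + 1 by lra.
exists (e / (M + 1)) => /=; first by rewrite divr_gt0.
move=> t /=; rewrite sub0r normrN ltr_pdivlMr// => te t0.
have := gK (t *: w + x); rewrite addrK dotpZr enormZ exprMn real_normK ?num_real// => H.
have t'0 : 0 < `|t| by rewrite normr_gt0.
rewrite -(ltr_pM2l t'0) -normrM mulrBr.
rewrite [_ *: (_ - _)]/GRing.scale/= mulVKf// -normrN opprB.
apply: le_lt_trans H _; rewrite mulrCA -/M -[t ^+ 2]real_normK ?num_real// expr2.
rewrite -mulrA ltr_pM2l//; apply: le_lt_trans te.
by rewrite ler_wpM2l// lerDl.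
Qed.

Lemma expansion_grad : grad g x = v.
Proof.
apply/rowP => i; rewrite mxE expansion_derive /dotp (bigD1 i)//= mxE !eqxx mulr1.
by rewrite big1 ?addr0// => j ji; rewrite mxE (negbTE ji) andbF mulr0.
Qed.

Lemma expansion_le z : `|g z - g x| <= (enorm v + K * enorm (z - x)) * enorm (z - x).
Proof.
rewrite -(subrK (dotp v (z - x)) (g z - g x)) (le_trans (ler_normD _ _))//.
rewrite mulrDl addrC lerD ?dotp_abs_le//.
by rewrite -mulrA -expr2.
Qed.

Lemma expansion_continuous : {for x, continuous g}.
Proof.
apply: (cvgrPdist_lt (FF := nbhs_filter x) _ _).2 => e e0.
have C0 : 0 < enorm v + K + 1 by rewrite ltr_wpDl// addr_ge0// enorm_ge0.
have ee : 0 < Num.min 1 (e / (enorm v + K + 1)).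
  by rewrite lt_min ltr01 divr_gt0.
apply: filterS (near_enorm_lt x ee) => z.
rewrite distrC => zx; apply: le_lt_trans (expansion_le z) _.
move: zx; rewrite lt_min ltr_pdivlMr// => /andP[z1]; apply: le_lt_trans.
rewrite mulrC ler_wpM2l ?enorm_ge0// -addrA lerD2l.
by rewrite ler_wpDr// ler_piMr// ltW.
Qed.

(** Close to [x] the quadratic error falls below any given multiple [e] of the distance. *)
Lemma expansion_subdiff (G : 'rV[R]_d -> \bar R) :
  (forall z, G z = (g z)%:E) -> subdiff G x v.
Proof.
move=> Gg; split; first by rewrite Gg.
move=> e e0; have K1 : 0 < K + 1 by rewrite ltr_wpDl.
have ee : 0 < e / (K + 1) by rewrite divr_gt0.
apply: filterS (near_enorm_lt x ee) => z; rewrite ltr_pdivlMr// => zx.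
rewrite !Gg -EFinD lee_fin; have := gK z; rewrite ler_norml => /andP[+ _].
have := enorm_ge0 (z - x); set s := enorm (z - x) in zx *.
set D := dotp v (z - x) => s0.
have : s * (s * (K + 1)) <= s * e by rewrite ler_wpM2l// ltW.
have := sqr_ge0 s; lra.
Qed.

End FirstOrderExpansion.

(** * The proximal map and the smoothness of the envelope *)

Section MoreauEnvelope.
Context {R : realType} {d : nat}.
Variables (k c : R) (f : 'rV[R]_d -> \bar R).
Hypotheses (c0 : 0 < c) (kc : k < c) (fN : avoids_ninfty f)
  (fcl : closed_function f) (fk : weakly_convex k f)
  (fp : exists z, f z != +oo%E).
Implicit Types (x y z : 'rV[R]_d).

Lemma growth_ge0 (s : R) : 0 <= (c - k) / 2 * s ^+ 2.
Proof. by rewrite mulr_ge0 ?sqr_ge0// divr_ge0// subr_ge0 ltW. Qed.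

Lemma prox_sig x : {p | f p \is a fin_num & forall z,
  (prox_objective c x f p + ((c - k) / 2 * enorm (z - p) ^+ 2)%:E
    <= prox_objective c x f z)%E}.
Proof.
apply: cid2; have [p fpp [_ pmin]] := prox_exists x kc fN fcl fk fp.
by exists p.
Qed.

(* Projecting from an opaque existence proof rather than reusing [argmin] keeps
   unification from unfolding [prox]. *)
Definition prox x : 'rV[R]_d := s2val (prox_sig x).

(** The real-valued form of the envelope; [moreauE] shows that [fine] loses nothing. *)
Definition envelope x : R := fine (moreau (1 / c) f x).

Lemma prox_fin x : f (prox x) \is a fin_num.
Proof. exact: s2valP (prox_sig x). Qed.

Lemma prox_min x z : (prox_objective c x f (prox x) +
  ((c - k) / 2 * enorm (z - prox x) ^+ 2)%:E <= prox_objective c x f z)%E.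
Proof. exact: s2valP' (prox_sig x) z. Qed.

Lemma moreau_prox x : moreau (1 / c) f x = prox_objective c x f (prox x).
Proof.
have E y : (f y + (1 / (2 * (1 / c)) * enorm (y - x) ^+ 2)%:E)%E
    = prox_objective c x f y.
  by rewrite /prox_objective; congr (_ + (_ * _)%:E)%E; field; rewrite gt_eqF.
apply/eqP; rewrite eq_le; apply/andP; split.
  by apply: ereal_inf_lbound; exists (prox x) => //; rewrite E.
apply: le_ereal_inf_tmp => _ [z _ <-]; rewrite E; apply: le_trans (prox_min x z).
by rewrite leeDl// lee_fin growth_ge0.
Qed.

Lemma envelope_prox x :
  envelope x = fine (f (prox x)) + c / 2 * enorm (prox x - x) ^+ 2.
Proof.
by rewrite /envelope moreau_prox /prox_objective -[f _]fineK ?prox_fin// -EFinD.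
Qed.

Lemma moreauE x : moreau (1 / c) f x = (envelope x)%:E.
Proof.
by rewrite moreau_prox envelope_prox /prox_objective EFinD fineK ?prox_fin.
Qed.

(** Any competitor [z] bounds the infimum; the extra quadratic term comes from the strong convexity
    of the subproblem. Most later estimates are this one with a suitable [z]. *)
Lemma envelope_growth x z (b : R) : f z = b%:E ->
  envelope x + (c - k) / 2 * enorm (z - prox x) ^+ 2 <= b + c / 2 * enorm (z - x) ^+ 2.
Proof.
move=> fz; have := prox_min x z.
by rewrite -moreau_prox moreauE /prox_objective fz -!EFinD lee_fin.
Qed.

(** The competitor at base point [z] is [prox x], and its squared distance to [z] is expanded around
    [x]. *)
Lemma envelope_le_at x z : envelope z + (c - k) / 2 * enorm (prox x - prox z) ^+ 2 <=
  envelope x + c * dotp (x - prox x) (z - x) + c / 2 * enorm (z - x) ^+ 2.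
Proof.
have := @envelope_growth z (prox x) _ (esym (fineK (prox_fin x))).
rewrite (sq_enorm_polar (prox x) x z) (envelope_prox x) => H.
by apply: le_trans H _; lra.
Qed.

(** Adding [envelope_le_at] in both directions cancels the envelope values and leaves
    [(c - k) * A ^+ 2] below [c] times an inner product; Cauchy-Schwarz and division by [A]
    finish. *)
Lemma prox_lipschitz x z : (c - k) * enorm (prox x - prox z) <= c * enorm (x - z).
Proof.
have H1 := envelope_le_at x z; have H2 := envelope_le_at z x.
rewrite (enorm_subC (prox z)) (enorm_subC x z) in H2.
have E := dotp_cross x z (prox x) (prox z).
rewrite (enorm_subC z x) in H1 H2.
have CS := dotp_le (prox x - prox z) (x - z).
set A := enorm (prox x - prox z) in H1 H2 CS *.
set B := enorm (x - z) in H1 H2 CS E *.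
have H3 : (c - k) * A ^+ 2 <= c * (A * B).
  have : c * dotp (prox x - prox z) (x - z) <= c * (A * B) by rewrite ler_pM2l.
  have : c * (dotp (x - prox x) (z - x) + dotp (z - prox z) (x - z)) =
    c * dotp (prox x - prox z) (x - z) - c * B ^+ 2 by rewrite E mulrBr.
  nra.
have A0 : 0 <= A := enorm_ge0 _; have B0 : 0 <= B := enorm_ge0 _.
have [->|An0] := eqVneq A 0; first by rewrite mulr0 mulr_ge0// ltW.
have Ap : 0 < A by rewrite lt0r An0.
by rewrite -(ler_pM2l Ap); nra.
Qed.

(** A constant that is not sharp: [c] controls the error from above, and [c ^+ 2 / (c - k)], which
    is [c] times the Lipschitz constant of [prox], controls it from below. *)
Definition envelope_modulus : R := c + c ^+ 2 / (c - k).

Lemma envelope_modulus_ge0 : 0 <= envelope_modulus.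
Proof. by rewrite addr_ge0 ?(ltW c0)// divr_ge0 ?sqr_ge0// subr_ge0 ltW. Qed.

(** The upper half is [envelope_le_at]. The lower half is the same inequality with [x] and [z]
    exchanged, where the change of gradient is absorbed by the Lipschitz bound. *)
Lemma envelope_expansion x z :
  `|envelope z - envelope x - dotp (c *: (x - prox x)) (z - x)|
    <= envelope_modulus * enorm (z - x) ^+ 2.
Proof.
have ck : 0 < c - k by rewrite subr_gt0.
have H1 := envelope_le_at x z; have H2 := envelope_le_at z x.
have L := prox_lipschitz x z.
have E := dotp_cross x z (prox x) (prox z).
have := dotp_le (prox x - prox z) (x - z).
rewrite (enorm_subC (prox z)) in H2.
rewrite (enorm_subC x z) in H1 H2 L E *.
rewrite dotpZl /envelope_modulus.
set D1 := dotp (x - prox x) _ in H1 E *; set D2 := dotp (z - prox z) _ in H2 E *.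
set D3 := dotp (prox x - prox z) _ in E *.
set A := enorm (prox x - prox z) in H1 H2 L *.
set B := enorm (z - x) in H1 H2 L E * => CS.
have A0 : 0 <= A := enorm_ge0 _; have B0 : 0 <= B := enorm_ge0 _.
have AA := growth_ge0 A.
have CAB : c * D3 <= c ^+ 2 / (c - k) * B ^+ 2.
  apply: (@le_trans _ _ (c * (A * B))); first by rewrite ler_pM2l.
  have -> : c ^+ 2 / (c - k) * B ^+ 2 = c * ((c * B / (c - k)) * B).
    by field; lra.
  by rewrite ler_pM2l// ler_wpM2r// ler_pdivlMr// mulrC.
have E' : c * D1 + c * D2 = c * D3 - c * B ^+ 2 by rewrite -mulrDr E mulrBr.
have Q0 : 0 <= c ^+ 2 / (c - k) * B ^+ 2.
  by rewrite mulr_ge0 ?sqr_ge0// divr_ge0 ?sqr_ge0// ltW.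
have BB : 0 <= c * B ^+ 2 by rewrite mulr_ge0 ?sqr_ge0// ltW.
rewrite ler_norml; apply/andP; split; lra.
Qed.

Lemma envelope_grad x : grad envelope x = c *: (x - prox x).
Proof. exact: expansion_grad envelope_modulus_ge0 (envelope_expansion x). Qed.

Lemma envelope_continuous : continuous envelope.
Proof. by move=> x; exact: expansion_continuous envelope_modulus_ge0 (envelope_expansion x). Qed.

Lemma envelope_subdiff x : subdiff (moreau (1 / c) f) x (c *: (x - prox x)).
Proof.
have H := expansion_subdiff envelope_modulus_ge0 (envelope_expansion x).
by apply: H => z; exact: moreauE.
Qed.

(** The residual is Lipschitz, so its smallness passes from iterates to a nearby cluster point. *)
Lemma prox_residual_le x z :
  enorm (x - prox x) <= enorm (z - prox z) + (1 + c / (c - k)) * enorm (x - z).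
Proof.
have ck : 0 < c - k by rewrite subr_gt0.
have /le_trans -> // := enorm_tri z x (prox x).
have : enorm (prox z - prox x) <= c / (c - k) * enorm (x - z).
  by rewrite enorm_subC mulrAC ler_pdivlMr// mulrC prox_lipschitz.
have := enorm_tri (prox z) z (prox x); rewrite mulrDl mul1r.
move: (enorm (z - prox x)) (enorm (z - prox z)) (enorm (prox z - prox x)).
move: (enorm (x - z)) (c / _ * _) => r1 r2 r3 r4 r5; lra.
Qed.

(** At a fixed point of [prox], the growth inequality minorizes [f] by its value at [x] minus
    [c / 2 * enorm (z - x) ^+ 2], which is of lower order. *)
Lemma prox_fixed_critical x : enorm (x - prox x) = 0 -> critical f x.
Proof.
move=> /enorm_eq0/eqP; rewrite subr_eq0 => /eqP px.
split; first by rewrite px prox_fin.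
move=> e e0; have ee : 0 < 2 * e / c by rewrite divr_gt0// mulr_gt0.
apply: filterS (near_enorm_lt x ee) => z; rewrite ltr_pdivlMr// => zx.
have fxfin := prox_fin x; rewrite -px in fxfin.
case fz : (f z) (fN z) => [b||]// _; last by rewrite leey.
have := envelope_growth x fz; rewrite envelope_prox -px subrr enorm0 expr0n mulr0 addr0.
rewrite /dotp big1 ?sub0r => [|i _]; last by rewrite mxE mul0r.
rewrite -[f x]fineK// -EFinD lee_fin.
have := enorm_ge0 (z - x); set s := enorm (z - x) in zx * => s0 H.
have sc : s * (s * c) <= s * (2 * e) by rewrite ler_wpM2l// ltW.
have := growth_ge0 s; lra.
Qed.

Lemma inf_le_envelope x : (ereal_inf (range f) <= (envelope x)%:E)%E.
Proof.
apply: (@le_trans _ _ (f (prox x))); first by apply: ereal_inf_lbound; exists (prox x).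
rewrite -[f _]fineK ?prox_fin// lee_fin envelope_prox lerDl mulr_ge0 ?sqr_ge0//.
by rewrite divr_ge0// ltW.
Qed.

End MoreauEnvelope.

(** * Kurdyka-Lojasiewicz convergence *)

Section Desingularizing.
Context {R : realType}.
Variables (eps : \bar R) (phi : R -> R).
Hypothesis phiD : desingularizing eps phi.

(** By concavity, secant slopes over short intervals ending at [a] are at most the chord slope [L],
    hence so is their limit. Only the derivative at [a] enters, so [b] may be 0. *)
Lemma desingularizing_tangent (a b : R) : 0 <= b -> b < a -> (a%:E < eps)%E ->
  derive1 phi a * (a - b) <= phi a - phi b.
Proof.
move=> b0 ba aeps; have [_ cvx _ _ /(_ a)] := phiD.
have a0 : 0 < a by exact: le_lt_trans ba.
move=> /(_ a0 aeps)[dphi _ _].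
have beps : (b%:E < eps)%E by apply: lt_trans aeps; rewrite lte_fin.
have conc (t : R) : 0 <= t -> t <= 1 -> t * phi b + (1 - t) * phi a <= phi (t * b + (1 - t) * a).
  move=> t0 t1; have := cvx (Itv01 t0 t1) b a.
  rewrite !inE => /(_ (conj b0 beps) (conj (ltW a0) aeps)) /=.
  move=> H.
  have H' : - phi (t * b + (1 - t) * a) <= t * - phi b + (1 - t) * - phi a := H.
  lra.
rewrite -ler_pdivlMr ?subr_gt0//.
set L := (phi a - phi b) / (a - b).
have slope (t : R) : 0 < t -> t <= 1 ->
    (t * (b - a))^-1 * (phi (t * (b - a) + a) - phi a) <= L.
  move=> t0 t1; have := conc t (ltW t0) t1.
  rewrite (_ : t * b + (1 - t) * a = t * (b - a) + a); last by ring.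
  have tn : 0 < t * (a - b) by rewrite mulr_gt0// subr_gt0.
  move: (phi (_ + a)) => p1 H.
  rewrite (_ : t * (b - a) = - (t * (a - b))); last by ring.
  rewrite invrN mulNr -mulrN mulrC ler_pdivrMr//.
  have -> : L * (t * (a - b)) = t * (phi a - phi b) by rewrite /L; field; lra.
  lra.
rewrite leNgt; apply/negP => Llt.
have e0 : 0 < derive1 phi a - L by rewrite subr_gt0.
move: dphi => /cvgrPdist_lt/(_ _ e0)[r /= r0 rP].
have ab0 : 0 < a - b by rewrite subr_gt0.
(* This weight keeps the point on the segment from [a] to [b] and within the radius where the
   difference quotient is close to the derivative. *)
set t := Num.min 1 (r / 2 / (a - b)).
have t0 : 0 < t by rewrite lt_min ltr01 !divr_gt0.
have t1 : t <= 1 by rewrite ge_min lexx.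
have tr : t * (a - b) < r.
  apply: (@le_lt_trans _ _ (r / 2)); last lra.
  by rewrite -ler_pdivlMr// ge_min lexx orbT.
have tab : 0 < t * (a - b) by rewrite mulr_gt0.
have tba : t * (b - a) = - (t * (a - b)) by ring.
have := rP (t * (b - a)); rewrite /= sub0r normrN tba normrN gtr0_norm//.
rewrite oppr_eq0 gt_eqF// => /(_ tr isT); rewrite -tba -/(derive phi a 1) -derive1E.
rewrite -[X in phi X]/(t * (b - a) * 1 + a) mulr1 ltr_norml => /andP[_].
set X := _ *: _ => H; have : X <= L := slope t t0 t1; lra.
Qed.

Lemma desingularizing_small (e : R) : 0 < e ->
  exists2 r : R, 0 < r & forall s, 0 <= s -> s < r -> (s%:E < eps)%E -> phi s < e.
Proof.
move=> e0; have [/subspace_continuousP phic _ _ phi0 _] := phiD.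
have [eps0|eps0] := ltP 0%E eps; last first.
  exists 1 => // s s0 _ /lt_le_trans/(_ eps0); rewrite lte_fin => ?; lra.
have /cvgrPdist_lt/(_ _ e0)/nbhs_ballP[r /= r0 rP] := phic 0 (conj (lexx _) eps0).
exists r => // s s0 sr seps.
have := rP s; rewrite /ball /= sub0r normrN ger0_norm// => /(_ sr (conj s0 seps)).
move=> H; have : `|phi 0 - phi s| < e := H.
by rewrite phi0 sub0r normrN; apply: le_lt_trans; exact: ler_norm.
Qed.

End Desingularizing.

(** * Descent sequences under the KL property *)

Section KLDescent.
Context {R : realType} {d : nat}.
Variables (G : 'rV[R]_d -> \bar R) (g : 'rV[R]_d -> R) (V : 'rV[R]_d -> 'rV[R]_d).
Variables (kappa : R) (x : nat -> 'rV[R]_d) (xbar : 'rV[R]_d).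
Hypotheses (Gg : forall z, G z = (g z)%:E) (gcont : continuous g)
  (VG : forall z, subdiff G z (V z)) (kappa0 : 0 < kappa)
  (descent : forall t,
     g (x t.+1) + kappa * (enorm (V (x t)) * enorm (x t.+1 - x t)) <= g (x t))
  (stationary : forall t, g (x t.+1) = g (x t) -> x t.+1 = x t)
  (xbar_cluster : cluster (x @ \oo) xbar).

Lemma cluster_frequently (U : set 'rV[R]_d) (N : nat) : nbhs xbar U ->
  exists2 n, (N <= n)%N & U (x n).
Proof.
move=> nU; have [|_ [[n Nn <-] Un]] := xbar_cluster (A := x @` [set n | (N <= n)%N]) _ nU.
  by exists N => // n /= Nn; exists n.
by exists n.
Qed.

Lemma values_nonincreasing s t : (s <= t)%N -> g (x t) <= g (x s).
Proof.
elim: t => [|t IH]; first by rewrite leqn0 => /eqP ->.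
rewrite leq_eqVlt => /predU1P[->//|]; rewrite ltnS => /IH; apply: le_trans.
apply: le_trans (descent t); rewrite lerDl mulr_ge0 ?(ltW kappa0)//.
by rewrite mulr_ge0 ?enorm_ge0.
Qed.

(** If the values ever fell below [g xbar], monotonicity would keep them there, away from [g xbar],
    and by continuity the sequence could not return near [xbar]. *)
Lemma values_ge_cluster t : g xbar <= g (x t).
Proof.
rewrite leNgt; apply/negP => gt.
have e0 : 0 < g xbar - g (x t) by rewrite subr_gt0.
have nU : nbhs xbar [set z | g (x t) < g z].
  have := gcont (x := xbar); rewrite /continuous_at => /cvgrPdist_lt/(_ _ e0).
  apply: filterS => z /=; rewrite ltr_norml => /andP[_].
  by rewrite ltrD2l ltrN2.
have [n tn /=] := cluster_frequently t nU.
by rewrite ltNge values_nonincreasing.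
Qed.

Local Notation step t := (enorm (x t.+1 - x t)).
Local Notation len n := (\sum_(0 <= t < n) step t).

Lemma summable_of_bounded (M : R) : (forall n, len n <= M) ->
  (\sum_(0 <= t <oo) (step t)%:E < +oo)%E.
Proof.
move=> lenM; apply: (@le_lt_trans _ _ M%:E); last exact: ltry.
apply: lime_le; first by apply: is_cvg_nneseries => n _ _; rewrite lee_fin enorm_ge0.
by apply: nearW => n; rewrite sumEFin lee_fin; exact: lenM.
Qed.

Lemma len_nondecreasing m n : (m <= n)%N -> len m <= len n.
Proof.
move=> mn; rewrite (big_cat_nat (n := m) (leq0n _) mn)/= lerDl.
by rewrite sumr_ge0// => i _; exact: enorm_ge0.
Qed.

Lemma cvg_of_enorm : (forall e : R, 0 < e ->
    exists N, forall n, (N <= n)%N -> enorm (x n - xbar) < e) ->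
  x @ \oo --> xbar.
Proof.
move=> xe; apply/cvgrPdist_lt => e e0; have [N NP] := xe e e0.
exists N => // n /= /NP; rewrite distrC; apply: le_lt_trans.
exact: norm_le_enorm.
Qed.

(** The KL inequality says nothing at the level [g xbar] itself. Once this level is reached the
    values are constant and [stationary] freezes the sequence. *)
Lemma KL_descent_stationary t0 : g (x t0) = g xbar ->
  x @ \oo --> xbar /\ (\sum_(0 <= t <oo) (step t)%:E < +oo)%E.
Proof.
move=> gt0.
have gn n : (t0 <= n)%N -> g (x n) = g xbar.
  move=> t0n; apply/eqP; rewrite eq_le values_ge_cluster andbT -gt0.
  exact: values_nonincreasing.
have stop n : (t0 <= n)%N -> x n.+1 = x n.
  by move=> t0n; apply: stationary; rewrite !gn// (leq_trans t0n).
have xn n : x (t0 + n)%N = x t0.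
  by elim: n => [|n IH]; rewrite ?addn0// addnS stop ?leq_addr.
have xn' n : (t0 <= n)%N -> x n = x t0 by move=> /subnKC <-; exact: xn.
split.
  apply: cvg_of_enorm => e e0; exists t0 => n /xn' ->.
  by have [m /xn' <-] := cluster_frequently t0 (near_enorm_lt xbar e0).
apply: (@summable_of_bounded (len t0)) => n.
have [/len_nondecreasing//|/ltnW t0n] := leqP n t0.
rewrite (big_cat_nat (n := t0) (leq0n _) t0n)/= gerDl.
rewrite big_nat_cond big1// => i /andP[/andP[t0i _] _].
by rewrite stop// subrr enorm0.
Qed.

Lemma KL_descent_convergence : KL_at G xbar ->
  x @ \oo --> xbar /\ (\sum_(0 <= t <oo) (step t)%:E < +oo)%E.
Proof.
move=> [eps [U [phi [eps0 nU phiD KL]]]].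
have [[t0 /KL_descent_stationary//]|] := pselect (exists t, g (x t) = g xbar).
move=> /forallNP gne.
have gpos t : 0 < g (x t) - g xbar.
  by rewrite subr_gt0 lt_neqAle values_ge_cluster andbT eq_sym; apply/eqP.
have [r0 r0_gt0 r0U] := nbhs_enormP nU.
(* A real threshold is needed because [eps] may be [+oo]. *)
have [e1 e1_gt0 e1eps] : exists2 e1 : R, 0 < e1 & (e1%:E <= eps)%E.
  by case: eps eps0 {phiD KL} => [e|//|//] e0; [exists e|exists 1; rewrite ?leey].
pose Phi t := phi (g (x t) - g xbar).
have geps t : g (x t) - g xbar < e1 -> ((g (x t) - g xbar)%:E < eps)%E.
  by move=> ge1; apply: lt_le_trans e1eps; rewrite lte_fin.
have phi_ge0 t : g (x t) - g xbar < e1 -> 0 <= Phi t.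
  have [_ _ + _ _] := phiD => phi0 /geps ?.
  by apply: phi0; split => //; exact: ltW.
(* Concavity makes the drop of [Phi] at least [derive1 phi] times the drop of [g], hence at least
   [kappa * derive1 phi] times subgradient norm times step; KL bounds [derive1 phi] times the
   subgradient norm below by 1. *)
have key t : enorm (x t - xbar) < r0 -> g (x t) - g xbar < e1 ->
    Phi t.+1 + kappa * step t <= Phi t.
  move=> /r0U Ut /[dup] ge1 /geps ge.
  have [_ _ _ _ /(_ _ (gpos t) ge)[_ _ dphi0]] := phiD.
  have gle : g (x t.+1) <= g (x t) by exact: values_nonincreasing.
  (* The tangent inequality needs a strict decrease; for equal values the step is zero. *)
  have [gE|gneq] := eqVneq (g (x t.+1)) (g (x t)).
    by rewrite (stationary gE) subrr enorm0 mulr0 addr0 /Phi gE.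
  have glt : g (x t.+1) - g xbar < g (x t) - g xbar.
    by rewrite ltrD2r lt_neqAle gneq.
  have := desingularizing_tangent phiD (ltW (gpos t.+1)) glt ge.
  have := KL _ Ut; rewrite !Gg lte_fin -subr_gt0 gpos => /(_ isT).
  rewrite addeC -lteBlDr// -EFinB ge => /(_ isT) KLt.
  have : (1 / derive1 phi (g (x t) - g xbar) <= enorm (V (x t)))%R.
    rewrite -lee_fin; apply: le_trans KLt _.
    by apply: ereal_inf_lbound; exists (V (x t)) => //; exact: VG.
  rewrite ler_pdivrMr// /Phi; have := descent t; have := enorm_ge0 (x t.+1 - x t).
  move: (phi _) (phi _) (derive1 phi _) dphi0 => p1 p2 dp dp0.
  move: (enorm (V _)) (enorm _) => v s s0 H1 H2 H3.
  have : kappa * s * 1 <= kappa * s * (v * dp).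
    by rewrite ler_wpM2l// mulr_ge0// ltW.
  have : dp * (kappa * (v * s)) <= dp * (g (x t) - g (x t.+1)).
    by rewrite ler_pM2l//; lra.
  lra.
(* [kappa * enorm (x n - xbar) + Phi n] is nonincreasing while [x] stays in the
   ball, so starting close enough to [xbar] traps the sequence there. *)
have trap (r : R) : 0 < r -> r <= r0 -> exists N, forall m,
    [/\ enorm (x (N + m)%N - xbar) < r, 0 <= Phi (N + m)%N &
        kappa * len (N + m) + Phi (N + m)%N <= kappa * len N + Phi N].
  (* The budget [kappa * r] is split evenly between the initial distance and the initial value of
     [Phi]. *)
  move=> r_gt0 rr0; have kr : 0 < kappa * (r / 2) by rewrite mulr_gt0// divr_gt0.
  have [s s0 phis] := desingularizing_small phiD kr.
  have s1 : 0 < Num.min s e1 by rewrite lt_min s0.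
  have nW : nbhs xbar [set z | enorm (z - xbar) < r / 2 /\ g z - g xbar < Num.min s e1].
    apply: filterI; first by apply: near_enorm_lt; rewrite divr_gt0.
    have := gcont (x := xbar); rewrite /continuous_at => /cvgrPdist_lt/(_ _ s1).
    by apply: filterS => z /=; rewrite distrC; apply: le_lt_trans; exact: ler_norm.
  have [N _ [xN]] := cluster_frequently 0 nW.
  rewrite lt_min => /andP[gNs gNe]; exists N.
  have PN : Phi N < kappa * (r / 2).
    by apply: phis => //; [exact: ltW|exact: geps].
  have ge1 m : g (x (N + m)%N) - g xbar < e1.
    by apply: le_lt_trans gNe; rewrite lerD2r values_nonincreasing ?leq_addr.
  have P0 m : 0 <= Phi (N + m)%N by exact: phi_ge0.
  have ball m : kappa * enorm (x (N + m)%N - xbar) + Phi (N + m)%N < kappa * r ->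
      enorm (x (N + m)%N - xbar) < r.
    by move=> H; rewrite -(ltr_pM2l kappa0); apply: le_lt_trans H; rewrite lerDl.
  have inv m : kappa * enorm (x (N + m)%N - xbar) + Phi (N + m)%N < kappa * r /\
      kappa * len (N + m) + Phi (N + m)%N <= kappa * len N + Phi N.
    elim: m => [|m [IH1 IH2]].
      rewrite addn0; split => //.
      have : kappa * enorm (x N - xbar) < kappa * (r / 2) by rewrite ltr_pM2l.
      move: PN; lra.
    have := key _ (lt_le_trans (ball _ IH1) rr0) (ge1 m).
    rewrite addnS (@big_nat_recr _ _ _ (N + m))//= mulrDr.
    have : kappa * enorm (x (N + m).+1 - xbar) <=
        kappa * (step (N + m) + enorm (x (N + m)%N - xbar)).
      by rewrite ler_pM2l//; exact: enorm_tri.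
    move: IH1 IH2; rewrite mulrDr.
    move: (kappa * step _) (kappa * enorm _) (kappa * enorm _) => a b c.
    move: (Phi (N + m)%N) (Phi (N + m).+1) (Phi N) (kappa * len _) (kappa * _) => *.
    split; lra.
  by move=> m; have [H1 H2] := inv m; split => //; exact: ball.
split.
  apply: cvg_of_enorm => e e0.
  have [||N NP] := trap (Num.min e r0); first by rewrite lt_min e0.
    by rewrite ge_min lexx orbT.
  exists N => n /subnKC <-; have [+ _ _] := NP (n - N)%N.
  by rewrite lt_min => /andP[].
have [//|//|N NP] := trap r0.
apply: (@summable_of_bounded ((kappa * len N + Phi N) / kappa)) => n.
rewrite ler_pdivlMr// mulrC; have [_ P0 H] := NP n.
apply: le_trans H; apply: ler_wpDr => //.
by rewrite ler_pM2l// len_nondecreasing// leq_addl.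
Qed.

End KLDescent.

(** * Descent of the envelope along the algorithm *)

(** If all [T + 1] squares exceeded the average [q], the accumulated decrease would push the values
    below the lower bound [i]. *)
Lemma min_gradient_bound (R : realType) (g G : nat -> R) (i : \bar R) (K : R) :
  0 < K -> (forall t, g t.+1 + K * G t ^+ 2 <= g t) -> (forall t, (i <= (g t)%:E)%E) ->
  (forall t, 0 <= G t) -> forall T : nat,
  (\big[mine/+oo]_(t < T.+1) (G t)%:E
     <= sqrte (((g 0%N)%:E - i) * ((K * (T + 1)%:R)^-1)%:E))%E.
Proof.
move=> K0 gdec ig G0 T; have := ig 0%N; have := ig T.+1.
have KT : 0 < K * (T + 1)%:R by rewrite mulr_gt0// ltr0n addn1.
(* For [i = -oo] the right-hand side is [+oo]. *)
case: i {ig} => [i||]//= => [|_ _]; last first.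
  by rewrite gt0_mulye ?lte_fin ?invr_gt0//= leey.
rewrite !lee_fin => iT i0; set q := (g 0%N - i) / (K * (T + 1)%:R).
suff [t tT Gq] : exists2 t : nat, (t < T.+1)%N & G t ^+ 2 <= q.
  apply/bigmin_leP; right; exists (Ordinal tT) => //=.
  rewrite -[leLHS]/((G t)%:E) lee_fin -[leLHS]ger0_norm// -sqrtr_sqr.
  by rewrite ler_sqrt// divr_ge0 ?(ltW KT)// subr_ge0.
apply: contrapT => /forall2NP Gq.
have {}Gq t : (t < T.+1)%N -> q < G t ^+ 2.
  by move=> tT; case: (Gq t) => // /negP; rewrite -ltNge.
have acc n : (n <= T.+1)%N -> g n + K * n%:R * q <= g 0%N.
  elim: n => [|n IH] nT; first by rewrite mulr0 mul0r addr0.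
  have := IH (ltnW nT); have := gdec n.
  have : K * q < K * G n ^+ 2 by rewrite ltr_pM2l// Gq.
  by rewrite -natr1; move: (g n.+1) (g n) => *; lra.
(* The accumulated bound is not strict, so it is stopped at [T] and the last decrease supplies
   strictness. *)
have := acc T (leqnSn T); have := gdec T.
have : K * q < K * G T ^+ 2 by rewrite ltr_pM2l// Gq.
have : K * (T + 1)%:R * q = g 0%N - i by rewrite /q mulrC divfK// gt_eqF.
by rewrite natrD; move: (g T.+1) iT (g T) => *; lra.
Qed.

(** * One step of the method compared with the proximal point *)

Section ModelStep.
Context {R : realType} {d : nat}.
Variables (rho eta beta tau c : R) (f h : 'rV[R]_d -> \bar R).
Hypotheses (c0 : 0 < c) (rc : rho < c) (fN : avoids_ninfty f)
  (fcl : closed_function f) (frho : weakly_convex rho f)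
  (fp : exists z, f z != +oo%E).
Variable x : 'rV[R]_d.
Hypotheses (hN : avoids_ninfty h) (hcl : closed_function h)
  (heta : weakly_convex eta h) (etatau : eta < tau)
  (fh : forall w, ext_close f h w (beta / 2 * enorm (w - x) ^+ 2)).

Local Notation p := (prox rc fN fcl frho fp x).
Local Notation y := (argmin (prox_objective tau x h)).

(** The model minimizer is tested against [p], and [p] as minimizer of the proximal objective of [f]
    is tested against the model minimizer. The model error at these two points links both
    inequalities. *)
Lemma model_step :
  (tau - beta - c) * enorm (y - x) ^+ 2 + (tau - eta + c - rho) * enorm (y - p) ^+ 2
  <= (beta + tau - c) * enorm (p - x) ^+ 2.
Proof.
have fpfin := prox_fin rc fN fcl frho fp x.
(* [ext_close] transfers finiteness, so each minimizer is an admissible competitor in the other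
   problem. *)
have [hpfin closep] : h p \is a fin_num /\
    `|fine (f p) - fine (h p)| <= beta / 2 * enorm (p - x) ^+ 2.
  by case: (fh p) => [[E]|[]//]; rewrite E in fpfin.
have [|q hq [-> qmin]] := prox_exists x etatau hN hcl heta.
  by exists p; case: (h p) hpfin.
have [fqfin closeq] : f q \is a fin_num /\
    `|fine (f q) - fine (h q)| <= beta / 2 * enorm (q - x) ^+ 2.
  by case: (fh q) => [[_ E]|[]//]; rewrite E in hq.
have := qmin p; rewrite /prox_objective -[h p]fineK// -[h q]fineK// -!EFinD lee_fin.
have := envelope_growth c0 rc fN fcl frho fp x (esym (fineK fqfin)).
rewrite (envelope_prox c0 rc fN fcl frho fp) (enorm_subC p q).
move: closep closeq; rewrite !ler_norml.
move: (enorm (q - p) ^+ 2) (enorm (p - x) ^+ 2) (enorm (q - x) ^+ 2) => D A B.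
move: (fine (f p)) (fine (f q)) (fine (h p)) (fine (h q)) => f1 f2 h1 h2.
move=> /andP[H1 H2] /andP[H3 H4] H5 H6; lra.
Qed.

(** The proximal point [p] of [x] serves as competitor for the envelope at the relaxed point, and
    [sq_enorm_conv] expands the distance. *)
Lemma relaxed_step (alpha : R) (z : 'rV[R]_d) :
  envelope c f ((1 - alpha) *: x + alpha *: z) <=
  envelope c f x + c * alpha / 2 * (enorm (z - p) ^+ 2 - enorm (p - x) ^+ 2
    - (1 - alpha) * enorm (z - x) ^+ 2).
Proof.
have fpfin := prox_fin rc fN fcl frho fp x.
set w := _ *: x + _.
have := envelope_growth c0 rc fN fcl frho fp w (esym (fineK fpfin)).
have wE : w = (1 - alpha) *: x + (1 - (1 - alpha)) *: z.
  by rewrite /w; congr (_ + _ *: _); ring.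
have := sq_enorm_conv (1 - alpha) x z p; rewrite -wE.
rewrite (enorm_subC p w) => -> H.
rewrite (envelope_prox c0 rc fN fcl frho fp x) (enorm_subC p x) (enorm_subC z x).
have : 0 <= (c - rho) / 2 * enorm (p - prox rc fN fcl frho fp w) ^+ 2.
  exact: growth_ge0.
move: H; move: (_ * enorm (p - _) ^+ 2) (envelope _ _ _) => r1 r2.
move: (enorm (x - p) ^+ 2) (enorm (x - z) ^+ 2) (enorm (z - p) ^+ 2) => D A B.
move: (fine _) => f1 *; lra.
Qed.

Local Notation s := (tau - c).

Lemma descent_step (alpha : R) :
  0 < alpha <= 1 -> c = tau / 2 + (rho + eta) / 4 -> 0 < beta -> beta < s ->
  envelope c f ((1 - alpha) *: x + alpha *: y)
    + c * alpha * (2 * s - beta) / (6 * s) * enorm (p - x) ^+ 2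
    + c * alpha * (s - beta) / (6 * s) * enorm (y - x) ^+ 2
  <= envelope c f x.
Proof.
move=> /andP[a0 a1] cE b0; set r := s => bs.
have := relaxed_step alpha y; have := model_step.
have : 0 <= enorm (y - x) ^+ 2 by exact: sqr_ge0.
have cp := c0.
move: (envelope _ _ _) (envelope _ _ _) => g1 g2.
move: (enorm (y - x) ^+ 2) (enorm (p - x) ^+ 2) (enorm (y - p) ^+ 2) => B A D B0.
have s0 : 0 < r by lra.
have -> : tau - beta - c = r - beta by rewrite /r; ring.
(* The choice of [c] balances the two moduli so that they add up to three times [tau - c]. *)
have -> : tau - eta + c - rho = 3 * r by rewrite /r cE; field.
have -> : beta + tau - c = r + beta by rewrite /r; ring.
clearbody r => H1 H2.
have ca : 0 < c * alpha by rewrite mulr_gt0.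
(* The factor turns the coefficient of [D] into [c * alpha / 2], which cancels the term from
   [relaxed_step]. *)
have H3 : c * alpha / (6 * r) * ((r - beta) * B + 3 * r * D)
    <= c * alpha / (6 * r) * ((r + beta) * A).
  by rewrite ler_pM2l// divr_gt0// mulr_gt0.
have E1 : c * alpha / (6 * r) * ((r - beta) * B + 3 * r * D) =
    c * alpha * (r - beta) / (6 * r) * B + c * alpha / 2 * D by field; lra.
have E2 : c * alpha * (2 * r - beta) / (6 * r) * A =
    c * alpha / 2 * A - c * alpha / (6 * r) * ((r + beta) * A) by field; lra.
have Q : 0 <= c * alpha / 2 * ((1 - alpha) * B).
  by rewrite mulr_ge0 ?divr_ge0 ?(ltW ca)// mulr_ge0// subr_ge0.
lra.
Qed.

End ModelStep.

(** * Descent and criticality along the iterates *)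

Section ModelBasedAlgorithm.
Context {R : realType} {d : nat}.
Variables (rho eta beta tau alpha c : R) (f : 'rV[R]_d -> \bar R).
Variables (model : 'rV[R]_d -> 'rV[R]_d -> \bar R) (x y : nat -> 'rV[R]_d).
Hypotheses (beta0 : 0 < beta) (fN : avoids_ninfty f)
  (fcl : closed_function f) (frho : weakly_convex rho f)
  (fp : exists z, f z != +oo%E).
Hypothesis modelP : forall z, [/\ avoids_ninfty (model z), closed_function (model z),
  weakly_convex eta (model z) &
  forall w, ext_close f (model z) w (beta / 2 * enorm (w - z) ^+ 2)].
Hypotheses (alpha01 : 0 < alpha <= 1) (c0 : 0 < c) (rc : rho < c) (etatau : eta < tau)
  (cE : c = tau / 2 + (rho + eta) / 4) (betas : beta < tau - c).
Hypothesis yE : forall t, y t = argmin (prox_objective tau (x t) (model (x t))).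
Hypothesis xE : forall t, x t.+1 = (1 - alpha) *: x t + alpha *: y t.

Local Notation s := (tau - c).
Local Notation P := (prox rc fN fcl frho fp).
Local Notation g := (envelope c f).
Local Notation residual t := (enorm (P (x t) - x t)).
Local Notation disp t := (enorm (y t - x t)).

Lemma algorithm_descent t :
  g (x t.+1) + c * alpha * (2 * s - beta) / (6 * s) * residual t ^+ 2
    + c * alpha * (s - beta) / (6 * s) * disp t ^+ 2 <= g (x t).
Proof.
have [mN mcl meta mclose] := modelP (x t).
rewrite xE yE.
exact: (descent_step c0 rc fN fcl frho fp mN mcl meta etatau mclose alpha01 cE
  beta0 betas).
Qed.

Lemma enorm_step t : enorm (x t.+1 - x t) = alpha * disp t.
Proof.
have [a0 _] := andP alpha01; rewrite xE -[in RHS](gtr0_norm a0) -enormZ; congr enorm.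
by apply/rowP => i; rewrite !mxE; ring.
Qed.

Lemma enorm_gradient t : enorm (c *: (x t - P (x t))) = c * residual t.
Proof. by rewrite enormZ gtr0_norm// enorm_subC. Qed.

Lemma algorithm_gradient_descent t :
  g (x t.+1) + alpha * (2 * c - rho - eta - beta) / (2 * c * (c + tau - rho - eta))
    * enorm (grad g (x t)) ^+ 2 <= g (x t).
Proof.
apply: le_trans (algorithm_descent t).
rewrite (envelope_grad c0 rc fN fcl frho fp) enorm_gradient.
have [a0 _] := andP alpha01; have [[cp bp] bs] := (c0, beta0, betas).
have s0 : 0 < s by lra.
(* The choice of [c] expresses both factors of the stated constant through [s]. *)
have -> : 2 * c - rho - eta - beta = 2 * s - beta by rewrite cE; field.
have -> : c + tau - rho - eta = 3 * s by rewrite cE; field.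
have -> : alpha * (2 * s - beta) / (2 * c * (3 * s)) * (c * residual t) ^+ 2 =
    c * alpha * (2 * s - beta) / (6 * s) * residual t ^+ 2.
  by move: (enorm _) => r; field; apply/andP; split; lra.
rewrite lerDl mulr_ge0 ?sqr_ge0// divr_ge0 ?mulr_ge0 ?(ltW cp) ?(ltW a0)//; lra.
Qed.

(* AM-GM turns the sum of squares of gradient and step into their product. *)
Lemma algorithm_product_descent t :
  g (x t.+1) + (s - beta) / (3 * s) *
    (enorm (c *: (x t - P (x t))) * enorm (x t.+1 - x t)) <= g (x t).
Proof.
apply: le_trans (algorithm_descent t); rewrite enorm_gradient enorm_step -[leRHS]addrA lerD2l.
have [a0 _] := andP alpha01; have [[cp bp] bs] := (c0, beta0, betas).
have s0 : 0 < s by lra.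
move: (disp t) (residual t) => b a.
set k := c * alpha / (6 * s).
have k0 : 0 < k by rewrite divr_gt0// mulr_gt0.
have -> : (s - beta) / (3 * s) * (c * a * (alpha * b)) = k * (2 * (s - beta) * (a * b)).
  by rewrite /k; field; lra.
have -> : c * alpha * (2 * s - beta) / (6 * s) * a ^+ 2 +
    c * alpha * (s - beta) / (6 * s) * b ^+ 2 =
    k * ((2 * s - beta) * a ^+ 2 + (s - beta) * b ^+ 2) by rewrite /k; field; lra.
rewrite ler_pM2l//.
(* The two sides differ by exactly this square plus [s * a ^+ 2]. *)
have : 0 <= (s - beta) * (a - b) ^+ 2 by rewrite mulr_ge0 ?sqr_ge0//; lra.
have : 0 <= s * a ^+ 2 by rewrite mulr_ge0 ?sqr_ge0// ltW.
lra.
Qed.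

(** The product form cannot give this when the gradient vanishes; the separate term in [disp t ^+ 2]
    of the full descent can. *)
Lemma algorithm_stationary t : g (x t.+1) = g (x t) -> x t.+1 = x t.
Proof.
move=> gE; have := algorithm_descent t; rewrite gE.
have [a0 _] := andP alpha01; have [[cp bp] bs] := (c0, beta0, betas).
have s0 : 0 < s by lra.
have C1 : 0 <= c * alpha * (2 * s - beta) / (6 * s) * residual t ^+ 2.
  by rewrite mulr_ge0 ?sqr_ge0// divr_ge0 ?mulr_ge0 ?(ltW cp) ?(ltW a0)//; lra.
have C2 : 0 < c * alpha * (s - beta) / (6 * s).
  by rewrite divr_gt0 ?mulr_gt0// subr_gt0.
move=> H; have : c * alpha * (s - beta) / (6 * s) * disp t ^+ 2 <= 0.
  by move: C1 H; move: (_ * residual t ^+ 2) (_ * disp t ^+ 2) (g _) => *; lra.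
rewrite pmulr_rle0// le_eqVlt ltNge sqr_ge0 orbF sqrf_eq0 => /eqP m0.
apply/eqP; rewrite -subr_eq0; apply/eqP/enorm_eq0.
by rewrite enorm_step m0 mulr0.
Qed.

(** The squared residual at [x t] is bounded by a multiple of [g (x t) - g xbar], which is small at
    iterates near [xbar]; the Lipschitz residual then vanishes at [xbar]. *)
Lemma algorithm_cluster_critical (xbar : 'rV[R]_d) :
  cluster (x @ \oo) xbar -> critical f xbar.
Proof.
move=> xbar_cl; suff fixed : enorm (xbar - P xbar) = 0.
  exact (prox_fixed_critical c0 fixed).
have [a0 _] := andP alpha01; have [[[cp bp] bs] rc'] := (c0, beta0, betas, rc).
have s0 : 0 < s by lra.
set C := c * alpha * (2 * s - beta) / (6 * s).
have C0 : 0 < C by rewrite divr_gt0 ?mulr_gt0//; lra.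
set L := 1 + c / (c - rho).
have L0 : 0 < L by rewrite addr_gt0// divr_gt0// subr_gt0.
have gcont := envelope_continuous c0 rc fN fcl frho fp.
have kappa0 : 0 < (s - beta) / (3 * s) by rewrite divr_gt0 ?mulr_gt0// subr_gt0.
have gge := values_ge_cluster (V := fun z => c *: (z - P z)) gcont kappa0
  algorithm_product_descent xbar_cl.
apply/eqP; rewrite eq_le enorm_ge0 andbT; apply/ler_addgt0Pr => e e0.
rewrite add0r.
have Ce : 0 < C * (e / 2) ^+ 2 by rewrite mulr_gt0// exprn_gt0// divr_gt0.
have Le : 0 < e / 2 / L by rewrite !divr_gt0.
(* Half of [e] pays for the residual at the iterate and half for its distance to [xbar], scaled by
   [L]. *)
have nW : nbhs xbar [set z | enorm (z - xbar) < e / 2 / L /\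
    g z - g xbar < C * (e / 2) ^+ 2].
  apply: filterI; first exact: near_enorm_lt.
  have := gcont xbar; rewrite /continuous_at => /cvgrPdist_lt/(_ _ Ce).
  by apply: filterS => z /=; rewrite distrC; apply: le_lt_trans; exact: ler_norm.
have [t _ [xt gt]] := cluster_frequently xbar_cl 0 nW.
apply: le_trans (prox_residual_le c0 rc fN fcl frho fp xbar (x t)) _.
rewrite -/L (splitr e) lerD//; last first.
  by rewrite enorm_subC mulrC -ler_pdivlMr// ltW.
rewrite enorm_subC -(@ler_pXn2r _ 2) ?nnegrE ?enorm_ge0 ?divr_ge0 ?(ltW e0)//.
rewrite -(ler_pM2l C0) ltW//; apply: le_lt_trans gt.
have := algorithm_descent t; rewrite -/C; have := gge t.+1.
have : 0 <= c * alpha * (s - beta) / (6 * s) * disp t ^+ 2.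
  rewrite mulr_ge0 ?sqr_ge0// divr_ge0 ?mulr_ge0 ?(ltW cp) ?(ltW a0)//; lra.
move: (_ * residual t ^+ 2) (_ * disp t ^+ 2) (g xbar) (g _) (g _) => *; lra.
Qed.

End ModelBasedAlgorithm.

Theorem theorem6p3 (R : realType) (d : nat) (rho eta beta : R)
    (f : 'rV[R]_d -> \bar R) (model : 'rV[R]_d -> 'rV[R]_d -> \bar R)
    (alpha tau : R) (x y : nat -> 'rV[R]_d) :
  0 < rho -> 0 < eta -> 0 < beta ->
  avoids_ninfty f -> closed_function f -> weakly_convex rho f ->
  (exists z, f z != +oo%E) ->
  (forall z, [/\ avoids_ninfty (model z), closed_function (model z),
                 weakly_convex eta (model z) &
                 forall w, ext_close f (model z) w
                             (beta / 2 * enorm (w - z) ^+ 2)]) ->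
  0 < alpha <= 1 ->
  Num.max (Num.max eta (2 * rho)) ((4 * beta + rho + eta) / 2) < tau ->
  (forall t, y t = argmin (fun z =>
               (model (x t) z + (tau / 2 * enorm (z - x t) ^+ 2)%:E)%E)) ->
  (forall t, x t.+1 = (1 - alpha) *: x t + alpha *: y t) ->
  let rhohat := tau / 2 + (rho + eta) / 4 in
  let env := moreau (1 / rhohat) f in
  (forall T : nat,
    (\big[mine/+oo]_(t < T.+1) (enorm (grad (fine \o env) (x t)))%:E
     <= sqrte ((env (x 0%N) - ereal_inf (range f)) *
          ((alpha * (2 * rhohat - rho - eta - beta)
            / (2 * rhohat * (rhohat + tau - rho - eta))
            * (T + 1)%:R)^-1)%:E))%E)
  /\
  ((forall sigma : R, rho < sigma -> KL_function (moreau (1 / sigma) f)) ->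
   forall xbar : 'rV[R]_d, cluster (x @ \oo) xbar ->
     [/\ critical f xbar,
         x @ \oo --> xbar &
         (\sum_(0 <= t <oo) (enorm (x t.+1 - x t))%:E < +oo)%E]).
Proof.
move=> rho0 eta0 beta0 fN fcl frho fp modelP alpha01 taumax yE xE c env.
have [etatau [rhotau betatau]] :
    eta < tau /\ 2 * rho < tau /\ (4 * beta + rho + eta) / 2 < tau.
  by move: taumax; rewrite !gt_max => /andP[/andP[-> ->] ->].
have c0 : 0 < c by rewrite /c; lra.
(* The bound [2 * rho < tau] gives this, and the third bound on [tau] amounts to
   [beta < tau - c]. *)
have rc : rho < c by rewrite /c; lra.
have betas : beta < tau - c by rewrite /c; lra.
have [a0 _] := andP alpha01.
have envE z : env z = (envelope c f z)%:E by exact: (moreauE c0 rc fN fcl frho fp).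
split=> [T|KL xbar xbar_cl].
  rewrite envE; apply: (@min_gradient_bound _ (fun t => envelope c f (x t))
    (fun t => enorm (grad (envelope c f) (x t)))).
  - by rewrite divr_gt0 ?mulr_gt0//; rewrite /c; lra.
  - move=> t; exact: (algorithm_gradient_descent beta0 fN fcl frho fp modelP alpha01
      c0 rc etatau erefl betas yE xE).
  - move=> t; exact: (inf_le_envelope c0 rc fN fcl frho fp).
  - by move=> t; exact: enorm_ge0.
have envsub := envelope_subdiff c0 rc fN fcl frho fp.
have kappa0 : 0 < (tau - c - beta) / (3 * (tau - c)).
  by rewrite divr_gt0 ?mulr_gt0//; lra.
(* The KL hypothesis is used at [sigma = c]; the envelope has the subgradient
   [c *: (xbar - prox xbar)], so the KL property holds at [xbar]. *)
have [xcvg xlen] := KL_descent_convergence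
  (V := fun z => c *: (z - prox rc fN fcl frho fp z)) envE
  (envelope_continuous c0 rc fN fcl frho fp) envsub kappa0
  (algorithm_product_descent beta0 fN fcl frho fp modelP alpha01 c0 rc etatau erefl
    betas yE xE)
  (algorithm_stationary beta0 fN fcl frho fp modelP alpha01 c0 rc etatau erefl
    betas yE xE) xbar_cl
  (let: And3 _ _ KLa := KL c rc in KLa xbar (ex_intro _ _ (envsub xbar))).
split => //.
exact: (algorithm_cluster_critical beta0 fN fcl frho fp modelP alpha01 c0 rc etatau
  erefl betas yE xE).
Qed.
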